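(* Let $G=(V,E,\sigma,o)$ be a radially symmetric tree with radially symmetric weight $\sigma$, and let $1<p<\infty$. An optimal density for $\mathrm{Mod}_{p,\sigma}(\Gamma_\infty)$ exists if and only if $\mathrm{Mod}_{p,\sigma}(\Gamma_\infty)>0$.
   Context: A weighted rooted tree $G=(V,E,\sigma,o)$ has root $o$ and weights $\sigma:E\to\mathbb{R}_{>0}$. The generation of an edge $e$ is the number of edges on the unique path from $o$ ending with $e$; $e$ is the parent of $e'$ if they are adjacent and $e'$ has generation one more. A proper infinite tree is infinite, locally finite, and every edge has at least one child; it is radially symmetric if the number of children of an edge depends only on its generation, and $\sigma$ is radially symmetric if $\sigma(e)$ depends only on the generation of $e$. A descending path is a path $e_1e_2\cdots$ from $o$ with $e_i$ the parent of $e_{i+1}$; $\Gamma_\infty$ is the set of infinite descending paths. For $\rho:E\to[0,\infty)$, $\ell_\rho(\gamma)=\sum_{e\in\gamma}\rho(e)$; $\mathrm{Adm}(\Gamma_\infty)$ is the set of such $\rho$ with $\ell_\rho(\gamma)\ge1$ for all $\gamma\in\Gamma_\infty$. $\mathcal{E}_{p,\sigma}(\rho)=\sum_{e\in E}\sigma(e)\rho(e)^p$ and $\mathrm{Mod}_{p,\sigma}(\Gamma_\infty)=\inf_{\rho\in\mathrm{Adm}(\Gamma_\infty)}\mathcal{E}_{p,\sigma}(\rho)$. An optimal density is $\rho^*\in\mathrm{Adm}(\Gamma_\infty)$ with $\mathcal{E}_{p,\sigma}(\rho^* )=\mathrm{Mod}_{p,\sigma}(\Gamma_\infty)$. *)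

(* Defs.v *)
(* MathComp / MathComp-Analysis *)
From HB Require Import structures.
From mathcomp Require Import all_boot all_order all_algebra.
From mathcomp Require Import finmap.
From mathcomp Require Import all_classical all_reals all_analysis.

Set Implicit Arguments.
Unset Strict Implicit.
Unset Printing Implicit Defensive.

Import Order.TTheory GRing.Theory Num.Theory.

Local Open Scope classical_set_scope.
Local Open Scope ring_scope.

(* Simple graphs; the vertex type may be infinite. *)
Record graph := Graph {
  vertex : choiceType;
  is_edge : pred {fset vertex};
  is_edge_card : forall e : {fset vertex}, is_edge e -> #|` e|%fset = 2%N }.

Definition edge (G : graph) : choiceType := {e : {fset vertex G} | is_edge e}.

Definition adj (G : graph) : rel (vertex G) :=
  fun x y => (x != y) && is_edge [fset x; y]%fset.
Arguments adj : clear implicits.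

Definition connected_graph (G : graph) : Prop :=
  forall x y : vertex G, exists2 s, path (adj G) x s & last x s = y.

(* An edge traversed back and forth is a [ucycle] of size 2. *)
Definition acyclic_graph (G : graph) : Prop :=
  forall s : seq (vertex G), ucycle (adj G) s -> (size s < 3)%N.

Definition is_tree (G : graph) : Prop := connected_graph G /\ acyclic_graph G.

Record weighted_rooted_tree (R : realType) := WeightedRootedTree {
  tgraph :> graph;
  tgraph_tree : is_tree tgraph;
  tree_root : vertex tgraph;
  weight : edge tgraph -> R;
  weight_gt0 : forall e, 0 < weight e }.
Arguments tree_root {R} _.
Arguments weight {R} _ _.

Section Trees.
Context {R : realType}.
Variable G : weighted_rooted_tree R.

(* [x :: s] is a vertex sequence; these are the edges it traverses, in order. *)
Definition path_edges (x : vertex G) (s : seq (vertex G)) :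
    seq {fset vertex G} :=
  pairmap (fun u v => [fset u; v]%fset) x s.

Definition has_generation (e : edge G) (n : nat) : Prop :=
  exists s : seq (vertex G),
    [/\ path (adj G) (tree_root G) s, uniq (tree_root G :: s),
        exists t, path_edges (tree_root G) s = rcons t (val e)
      & size (path_edges (tree_root G) s) = n].

(* The default value 0 is never used: in a tree such an [n] exists, is unique
   and is at least 1. *)
Definition generation (e : edge G) : nat := xget 0%N (has_generation e).

Definition adjacent_edges (e e' : edge G) : Prop :=
  e <> e' /\ exists x : vertex G, x \in val e /\ x \in val e'.

Definition parent (e e' : edge G) : Prop :=
  adjacent_edges e e' /\ generation e' = (generation e).+1.

Definition children (e : edge G) : set (edge G) := [set e' | parent e e'].

Definition locally_finite : Prop :=
  forall x : vertex G, finite_set [set y | adj G x y].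

Definition proper_infinite_tree : Prop :=
  [/\ infinite_set [set: vertex G], locally_finite
    & forall e : edge G, children e !=set0].

Definition radially_symmetric_tree : Prop :=
  proper_infinite_tree /\
  forall e e' : edge G, generation e = generation e' ->
    (children e #= children e')%card.

Definition radially_symmetric_weight : Prop :=
  forall e e' : edge G, generation e = generation e' ->
    weight G e = weight G e'.

(* The path e_1 e_2 ... is indexed from 0: [g i] is e_(i+1). *)
Definition Gamma_oo : set (nat -> edge G) :=
  [set g | tree_root G \in val (g 0%N) /\ forall i, parent (g i) (g i.+1)].

Definition rho_length (rho : edge G -> R) (g : nat -> edge G) : \bar R :=
  (\sum_(0 <= i <oo) (rho (g i))%:E)%E.

Definition Adm : set (edge G -> R) :=
  [set rho | (forall e, 0 <= rho e) /\
             forall g, Gamma_oo g -> (1%:E <= rho_length rho g)%E].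

Definition energy (p : R) (rho : edge G -> R) : \bar R :=
  (\esum_(e in [set: edge G]) (weight G e * rho e `^ p)%:E)%E.

Definition Mod (p : R) : \bar R := ereal_inf [set energy p rho | rho in Adm].

Definition optimal_density (p : R) (rho : edge G -> R) : Prop :=
  Adm rho /\ energy p rho = Mod p.

End Trees.

Arguments Mod {R} G p.
Arguments optimal_density {R} G p rho.

(* Main.v *)
Require Import Defs.
From mathcomp Require Import all_boot all_order all_algebra.
From mathcomp Require Import finmap zify lra.
From mathcomp Require Import all_classical all_reals all_analysis.

Set Implicit Arguments.
Unset Strict Implicit.
Unset Printing Implicit Defensive.

Import Order.TTheory GRing.Theory Num.Theory.

Local Open Scope classical_set_scope.
Local Open Scope ring_scope.

(** Let [c_n] be the total weight of the edges of generation [n], and let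
    [u_n = c_n ^ (- 1 / (p - 1))]. If [S = sum u_n] is finite, the radial density
    [u_n / S] is optimal. Indeed its energy is at most [S ^ (1 - p)], and bounding
    [x ^ p] below by its tangent at [u_n / S] shows that an admissible [rho] has
    energy at least [S ^ (1 - p)] as soon as [rho] has mass at least 1 against the
    uniform unit flow. If that mass were [a < 1], then starting from the root one
    could always move to a child whose subtree carries at most its fair share of
    what remains of the budget [a], and the resulting infinite path would have
    length at most [a]. If [S] is infinite, the normalized truncations of [u] have
    energies tending to 0, so the modulus vanishes. Finally a density of zero
    energy is zero, hence not admissible. *)

(** * Simple paths and generations in a tree *)

Section TreePaths.
Context {R : realType}.
Variable G : weighted_rooted_tree R.
Local Notation o := (tree_root G).

Lemma adj_sym : symmetric (adj G).
Proof. by move=> x y; rewrite /adj eq_sym fsetUC. Qed.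

(** Two different simple paths with the same ends would, between their first divergence and their
    next meeting, enclose a cycle of length at least 3. *)
Lemma uniq_path_inj (x : vertex G) (p q : seq (vertex G)) :
  path (adj G) x p -> path (adj G) x q -> uniq (x :: p) -> uniq (x :: q) ->
  last x p = last x q -> p = q.
Proof.
have [_ acyc] := tgraph_tree G.
elim: p x q => [|a p IH] x [|b q] //.
- move=> _ _ _ /= /andP[xq _] eq_x.
  by move: xq; rewrite {1}eq_x mem_last.
- move=> _ _ /= /andP[xp _] _ eq_x.
  by move: xp; rewrite -{1}eq_x mem_last.
have [<-|neq_ab] := eqVneq a b.
  move=> /= /andP[_ pp] /andP[_ pq] /andP[_ up] /andP[_ uq] e.
  by rewrite (IH a q).
move=> pP pQ uP uQ eq_last; exfalso.
have hPQ : has (mem (b :: q)) (a :: p).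
  apply/hasP; exists (last a p); first exact: mem_last.
  by move: eq_last => /= ->; exact: mem_last.
(* The first vertex [z] of [a :: p] lying on [b :: q] closes a cycle through [x]. *)
move: pP pQ uP uQ hPQ {eq_last}.
move E: (a :: p) => P; move F: (b :: q) => Q pP pQ uP uQ hPQ.
case: (split_find hPQ) E pP uP => z p1 p2 zQ p1Q E pP uP.
case: (splitPr zQ) F pQ uQ p1Q => q1 q2 F pQ uQ p1Q.
have pp1 : path (adj G) x (rcons p1 z).
  by move: pP; rewrite cat_path => /andP[].
have pq1 : path (adj G) z (rcons (rev q1) x).
  have : path (adj G) x (rcons q1 z).
    by move: pQ; rewrite -cat_rcons cat_path => /andP[].
  rewrite -(eq_path (e := fun u => (adj G)^~ u)); last first.
    by move=> u v; rewrite adj_sym.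
  by rewrite -rev_path last_rcons belast_rcons rev_cons.
have lt3 : (size (x :: rcons p1 z ++ rev q1) < 3)%N.
  apply: acyc; rewrite /ucycle /= rcons_cat cat_path pp1 last_rcons pq1 /=.
  have {uP} : uniq (x :: rcons p1 z) by move: uP; rewrite -cat_cons cat_uniq => /andP[].
  have {uQ} : uniq (x :: rcons q1 z).
    by move: uQ; rewrite -cat_rcons -cat_cons cat_uniq => /andP[].
  rewrite !cons_uniq !rcons_uniq !mem_rcons !inE !negb_or mem_cat cat_uniq.
  rewrite !rcons_uniq mem_rcons inE rev_uniq !mem_rev.
  move=> /and3P[/andP[_ xq1] zq1 ->] /and3P[/andP[xz xp1] -> ->].
  rewrite (negPf xz) (negPf xp1) (negPf xq1) /= andbT.
  apply/hasPn => y; rewrite mem_rev => yq1.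
  rewrite mem_rcons inE negb_or; apply/andP; split.
    by apply: contraNneq zq1 => <-.
  by apply: contra p1Q => yp1; apply/hasP; exists y => //=; rewrite mem_cat yq1.
move: lt3; rewrite /= size_cat size_rcons size_rev => lt3.
(* The bound leaves no room for [p1] and [q1]: both paths leave [x] through [z], against
   [neq_ab]. *)
case: p1 q1 E F lt3 {pP uP pp1 pq1 p1Q zQ pQ uQ}
  => [|? [|? ?]] [|? ?] //= [eqa _] [eqb _] _.
by rewrite eqa eqb eqxx in neq_ab.
Qed.

Definition simple_path (s : seq (vertex G)) := path (adj G) o s && uniq (o :: s).

Lemma simple_path_inj s t :
  simple_path s -> simple_path t -> last o s = last o t -> s = t.
Proof. by move=> /andP[? ?] /andP[? ?]; exact: uniq_path_inj. Qed.

Lemma simple_path_rcons s y :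
  simple_path (rcons s y) =
  [&& simple_path s, adj G (last o s) y & y \notin o :: s].
Proof.
rewrite /simple_path rcons_path -rcons_cons rcons_uniq.
by case: path; case: adj; case: uniq; case: (_ \notin _).
Qed.

Lemma simple_path_cat s t : simple_path (s ++ t) -> simple_path s.
Proof.
by rewrite /simple_path cat_path -cat_cons cat_uniq => /andP[/andP[-> _] /andP[->]].
Qed.

Lemma simple_path_to x : exists2 s, simple_path s & last o s = x.
Proof.
have [conn _] := tgraph_tree G.
have [s ps <-] := conn o x.
case: (shortenP ps) => s' ps' us' _.
by exists s' => //; rewrite /simple_path ps'.
Qed.

(** Working form of the definition: the path is split at its last edge, so that [y] is the endpoint
    farther from the root. *)
Lemma has_generationP (e : edge G) n : has_generation e n <->
  exists s y, [/\ simple_path (rcons s y), val e = [fset last o s; y]%fset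
                & n = (size s).+1].
Proof.
split.
  move=> [s [ps us [t et] <-]]; case/lastP: s ps us et => [|s y] ps us et.
    by case: t et.
  exists s, y; rewrite /simple_path ps us; split => //.
    move: et; rewrite /path_edges -cats1 pairmap_cat /= cats1.
    by move=> /rcons_inj[_ <-].
  by rewrite /path_edges size_pairmap size_rcons.
move=> [s [y [/andP[ps us] ey ->]]]; exists (rcons s y); split => //.
  exists (path_edges o s).
  by rewrite /path_edges -cats1 pairmap_cat /= cats1 ey.
by rewrite /path_edges size_pairmap size_rcons.
Qed.

Lemma edgeE (e : edge G) : exists x y, val e = [fset x; y]%fset /\ adj G x y.
Proof.
have := is_edge_card (valP e); have := fset_uniq (val e).
case E : (enum_fset (val e)) => [|x [|y []]] //=; rewrite inE andbT => neq_xy _.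
have exy : val e = [fset x; y]%fset.
  by apply/fsetP => z; rewrite -[z \in val e]/(z \in enum_fset (val e)) E !inE.
by exists x, y; rewrite /adj neq_xy -exy (valP e).
Qed.

Lemma has_generation_exists (e : edge G) : exists n, has_generation e n.
Proof.
have [x [y [exy axy]]] := edgeE e.
have [s ss sx] := simple_path_to x.
suff [t [z [st et]]] : exists t z, simple_path (rcons t z) /\
    val e = [fset last o t; z]%fset.
  by exists (size t).+1; apply/has_generationP; exists t, z.
(* Either the path to [x] avoids [y] and is extended by [y], or it is cut at [y] and extended by
   [x]. *)
have [ys|ys] := boolP (y \in o :: s); last first.
  by exists s, y; rewrite simple_path_rcons ss sx axy ys.
move: ss sx; case: (splitPl ys) => s1 s2 s1y ss; rewrite last_cat s1y => s2x.
have xs1 : x \notin o :: s1.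
  have neq_yx : y != x by case/andP: axy; rewrite eq_sym.
  move: ss => /andP[_]; rewrite -cat_cons cat_uniq => /and3P[_ /hasPn h _].
  apply: h; case: s2 s2x => [/= eyx|z s2 /= <-]; last exact: mem_last.
  by rewrite eyx eqxx in neq_yx.
exists s1, x; rewrite simple_path_rcons (simple_path_cat ss) s1y adj_sym axy xs1.
by rewrite fsetUC.
Qed.

Lemma fset2_inj (T : choiceType) (x y x' y' : T) :
  [fset x; y]%fset = [fset x'; y']%fset ->
  (x = x' /\ y = y') \/ (x = y' /\ y = x').
Proof.
move=> e.
have /fset2P hx : x \in [fset x'; y']%fset by rewrite -e !inE eqxx.
have /fset2P hy : y \in [fset x'; y']%fset by rewrite -e !inE eqxx orbT.
have /fset2P hx' : x' \in [fset x; y]%fset by rewrite e !inE eqxx.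
have /fset2P hy' : y' \in [fset x; y]%fset by rewrite e !inE eqxx orbT.
by case: hx hy hx' hy' => -> [] -> [] ? [] ?; subst; auto.
Qed.

(** Two simple paths cannot end with the same edge in opposite directions: [rcons s' y'] would be
    [s], which would then already pass through [y], the end of [s']. *)
Lemma simple_path_last_edge s y s' y' :
  simple_path (rcons s y) -> simple_path (rcons s' y') ->
  [fset last o s; y]%fset = [fset last o s'; y']%fset -> s = s'.
Proof.
move=> sy sy' /fset2_inj[[_ eq_y]|[eq_s eq_y]].
  apply: (@rcons_injl _ y).
  by apply: simple_path_inj; rewrite ?last_rcons // eq_y.
move: sy sy'; rewrite !simple_path_rcons => /and3P[ss sadj sy] /and3P[ss' sadj' sy'].
have : rcons s' y' = s.
  by apply: simple_path_inj; rewrite ?last_rcons ?simple_path_rcons ?ss' ?sadj'.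
by move=> es; move: sy; rewrite -es eq_y -rcons_cons mem_rcons inE mem_last orbT.
Qed.

Lemma generationP (e : edge G) :
  exists s y, [/\ simple_path (rcons s y), val e = [fset last o s; y]%fset
                & generation e = (size s).+1].
Proof.
apply/has_generationP; rewrite /generation.
have [n hn] := has_generation_exists e.
exact: (@xgetPex _ 0%N _ (ex_intro _ n hn)).
Qed.

Lemma generationE (e : edge G) s y :
  simple_path (rcons s y) -> val e = [fset last o s; y]%fset ->
  generation e = (size s).+1.
Proof.
move=> ss es; have [t [z [st et ->]]] := generationP e.
by rewrite (simple_path_last_edge ss st) // -es -et.
Qed.

Lemma generation_root (e : edge G) : generation e = 1%N <-> o \in val e.
Proof.
split=> [|oe].
  have [s [y [ss -> ->]]] := generationP e.
  by case: s ss => // _ _; rewrite !inE eqxx.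
have [x [y [exy axy]]] := edgeE e.
have [z [ez az]] : exists z, val e = [fset o; z]%fset /\ adj G o z.
  move: oe; rewrite exy => /fset2P[->|->]; first by exists y.
  by exists x; rewrite fsetUC adj_sym.
apply: (@generationE _ [::] z) => //.
by rewrite -[rcons _ _]/([:: z]) /simple_path /= az inE; case/andP: az => ->.
Qed.

Lemma parent_uniq (e e' c : edge G) : parent e c -> parent e' c -> e = e'.
Proof.
have [s [y [sy cE cg]]] := generationP c.
suff main f : parent f c -> exists t z, [/\ s = rcons t z &
    val f = [fset last o t; z]%fset].
  move=> /main[t [z [es fE]]] /main[t' [z' [es' fE']]]; apply: val_inj.
  by move: es; rewrite fE fE' es' => /rcons_inj[-> ->].
move=> [[_ [x [xf xc]]] gen]; have [t [z [tz fE fg]]] := generationP f.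
exists t, z; split => //.
move: gen; rewrite cg fg => -[eq_size].
have [ss _ _] := and3P (etrans (esym (simple_path_rcons s y)) sy).
have [st _ _] := and3P (etrans (esym (simple_path_rcons t z)) tz).
have size_eq u v : simple_path u -> simple_path v -> last o u = x ->
  last o v = x -> u = v.
  by move=> su sv eu ev; apply: simple_path_inj; rewrite // eu ev.
(* Path lengths rule out every case but one: the shared vertex [x] is the far end of [f] and the
   near end of [c]. *)
move: xf xc; rewrite cE fE => /fset2P[] xE /fset2P[] xE'.
- have /(congr1 size) := size_eq t s st ss (esym xE) (esym xE').
  by lia.
- have := size_eq t (rcons s y) st sy (esym xE).
  by rewrite last_rcons => /(_ (esym xE'))/(congr1 size); rewrite size_rcons; lia.
- by apply: size_eq => //; rewrite last_rcons.
- have := size_eq (rcons t z) (rcons s y) tz sy.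
  by rewrite !last_rcons => /(_ (esym xE) (esym xE'))/(congr1 size);
    rewrite !size_rcons; lia.
Qed.

Lemma parent_exists (c : edge G) n :
  generation c = n.+2 -> exists2 e, generation e = n.+1 & parent e c.
Proof.
have [s [y [sy cE ->]]] := generationP c.
case/lastP: s sy cE => [|t z] // sy cE [size_s].
have := sy; rewrite simple_path_rcons => /and3P[tz _ ny].
have /and3P[_ az _] := etrans (esym (simple_path_rcons t z)) tz.
pose e : edge G := Sub [fset last o t; z]%fset (proj2 (andP az)).
have ge : generation e = (size t).+1 by apply: (generationE tz); rewrite SubK.
exists e; first by rewrite ge -size_s size_rcons.
split; last by rewrite ge (generationE sy cE) size_rcons.
split.
  move=> ec; have : y \in val e by rewrite ec cE !inE eqxx orbT.
  rewrite SubK => /fset2P[] yE; move: ny; rewrite yE -rcons_cons mem_rcons inE.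
    by rewrite mem_last orbT.
  by rewrite eqxx.
by exists z; rewrite cE last_rcons !inE eqxx orbT.
Qed.

End TreePaths.

(** * Real series and powers *)

Section Series.
Context {R : realType}.

(** Partial sums increase, so those from [m] on suffice; truncated profiles use this with [m] the
    cut-off. *)
Lemma nneseries_le (u : nat -> R) m (B : R) : (forall n, 0 <= u n) ->
  (forall n, (m <= n)%N -> \sum_(i < n) u i <= B) ->
  (\sum_(0 <= i <oo) (u i)%:E <= B%:E)%E.
Proof.
move=> u0 uB; apply: lime_le.
  by apply: is_cvg_nneseries => n _ _; rewrite lee_fin.
near=> n; rewrite sumEFin lee_fin big_mkord; apply: uB.
by near: n; exact: nbhs_infty_ge.
Unshelve. all: by end_near. Qed.

Lemma le_nneseries (u : nat -> R) n : (forall n, 0 <= u n) ->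
  ((\sum_(i < n) u i)%:E <= \sum_(0 <= i <oo) (u i)%:E)%E.
Proof.
by move=> u0; rewrite -(big_mkord xpredT) -sumEFin nneseries_lim_ge // => k _ _;
   rewrite lee_fin.
Qed.

(** This is Young's inequality for [x] and the (p - 1)-th power of [a], with conjugate exponents [p]
    and [p / (p - 1)]. *)
Lemma powR_tangent_le (p x a : R) : 1 < p -> 0 <= x -> 0 <= a ->
  p * a `^ (p - 1) * x - (p - 1) * a `^ p <= x `^ p.
Proof.
move=> p1 x0 a0; have p0 : 0 < p by lra.
have pm1 : 0 < p - 1 by lra.
have := @conjugate_powR R x (a `^ (p - 1)) p (p / (p - 1)) x0 (powR_ge0 _ _) p0.
rewrite divr_gt0 // => /(_ isT).
rewrite {1}invf_div mulrBl divff ?gt_eqF // mul1r subrKC => /(_ erefl).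
rewrite -powRrM (mulrC p) mulrA divff ?gt_eqF // mul1r.
rewrite invfM invrK [a `^ p * _]mulrA [a `^ p * _]mulrC.
rewrite -mulrDl ler_pdivlMr // => h; by rewrite lerBlDr -mulrA mulrC [X in X * p]mulrC.
Qed.

End Series.

(** * Levels of the tree and paths of small length *)

Section Levels.
Context {R : realType}.
Variable G : weighted_rooted_tree R.
Hypothesis proper : proper_infinite_tree G.
Local Notation o := (tree_root G).

Lemma finite_incident (x : vertex G) : finite_set [set e : edge G | x \in val e].
Proof.
have [_ lf _] := proper.
apply: (@sub_finite_set _ _ ((val : edge G -> _) @^-1`
    ((fun y => [fset x; y]%fset) @` [set y | adj G x y]))); last first.
  apply: finite_preimage; last exact: finite_image (lf x).
  by move=> ? ? _ _; exact: val_inj.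
move=> e /=; have [y [z [-> ayz]]] := edgeE e.
move=> /fset2P[->|->]; first by exists z.
by exists y; rewrite 1?fsetUC //= adj_sym.
Qed.

Lemma finite_children (e : edge G) : finite_set (children e).
Proof.
have [x [y [exy _]]] := edgeE e.
apply: (@sub_finite_set _ _ ([set c : edge G | x \in val c] `|`
  [set c : edge G | y \in val c])).
  move=> c [[_ [z [ze zc]]] _].
  by move: ze; rewrite exy => /fset2P[] <-; [left|right].
by rewrite finite_setU; split; exact: finite_incident.
Qed.

Definition offspring (e : edge G) : {fset edge G} := fset_set (children e).

Lemma in_offspring e c : c \in offspring e <-> parent e c.
Proof. by rewrite in_fset_set ?inE //; exact: finite_children. Qed.

Lemma finite_generation n : finite_set [set e : edge G | generation e = n.+1].
Proof.
elim: n => [|n IH].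
  apply: sub_finite_set (finite_incident o) => e /=.
  by rewrite generation_root.
apply: (@sub_finite_set _ _ (\bigcup_(e in [set e | generation e = n.+1]) children e)).
  by move=> c /= /parent_exists[e ge ec]; exists e.
by apply: bigcup_finite => // e _; exact: finite_children.
Qed.

(** Shifted by one because generations start at 1: [level 0] consists of the edges at the root. *)
Definition level n : {fset edge G} := fset_set [set e | generation e = n.+1].

Lemma in_level n e : (e \in level n) = (generation e == n.+1).
Proof.
rewrite in_fset_set; last exact: finite_generation.
by apply/idP/eqP; rewrite inE.
Qed.

Lemma generation_gt0 (e : edge G) : (0 < generation e)%N.
Proof. by have [s [y [_ _ ->]]] := generationP e. Qed.

(** The offspring of the edges of [level n] partition [level n.+1]: disjointness is [parent_uniq],
    covering is [parent_exists]. *)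
Lemma sum_offspring_level (V : nmodType) (f : edge G -> V) n :
  \sum_(e <- level n) \sum_(c <- offspring e) f c = \sum_(c <- level n.+1) f c.
Proof.
transitivity (\sum_(c <- [seq c | e <- level n, c <- offspring e]) f c).
  by rewrite big_allpairs_dep.
apply: perm_big; apply: uniq_perm.
- apply: allpairs_uniq_dep; [exact: fset_uniq|by move=> e _; exact: fset_uniq|].
  move=> _ _ /allpairsPdep[e [c [_ ec ->]]] /allpairsPdep[e' [c' [_ ec' ->]]] /=.
  move=> cc'; rewrite cc' in ec *.
  by rewrite (parent_uniq ((in_offspring _ _).1 ec) ((in_offspring _ _).1 ec')).
- exact: fset_uniq.
move=> c; rewrite in_level; apply/allpairsPdep/eqP => [[e [c' [el ec ->]]]|gc].
  have [_ ->] := (in_offspring _ _).1 ec.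
  by move: el; rewrite in_level => /eqP ->.
have [e ge ec] := parent_exists gc.
by exists e, c; split; rewrite ?in_level ?ge //; apply/in_offspring.
Qed.

Lemma offspring_neq0 e : offspring e != fset0.
Proof.
have [_ _ /(_ e)[c ec]] := proper.
by apply/fset0Pn; exists c; apply/in_offspring.
Qed.

Lemma level_neq0 n : level n != fset0.
Proof.
elim: n => [|n /fset0Pn[e]].
  have [infV _ _] := proper.
  have [x xo] : exists x, x <> o.
    apply: contrapT => /forallNP h; apply: infV.
    by apply: sub_finite_set (finite_set1 o) => x _; apply: contrapT (h x).
  have [conn _] := tgraph_tree G.
  have [[|y s] /=] := conn o x; first by move=> _ eox; case: xo.
  move=> /andP[oy _] _; apply/fset0Pn.
  exists (Sub [fset o; y]%fset (proj2 (andP oy)) : edge G).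
  by rewrite in_level; apply/eqP/generation_root; rewrite SubK !inE eqxx.
rewrite in_level => /eqP ge.
have /fset0Pn[c /in_offspring[_ gc]] := offspring_neq0 e.
by apply/fset0Pn; exists c; rewrite in_level gc ge.
Qed.

Lemma enum_fset_neq0 (T : choiceType) (A : {fset T}) :
  A != fset0 -> enum_fset A != [::].
Proof.
move=> /fset0Pn[x]; apply: contraTneq.
by rewrite -[x \in A]/(x \in enum_fset A) => ->.
Qed.

(** * Greedy descent along a flow *)

Section Greedy.
Variables (theta rho : edge G -> R).
Hypothesis theta_gt0 : forall e, 0 < theta e.
Hypothesis rho_ge0 : forall e, 0 <= rho e.
Hypothesis theta_offspring : forall e, \sum_(c <- offspring e) theta c = theta e.

(** Mass of [rho] against the flow [theta] in the subtree below [e], cut at depth [n] to keep all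
    sums finite. *)
Fixpoint subtree_mass n e : R := theta e * rho e +
  if n is m.+1 then \sum_(c <- offspring e) subtree_mass m c else 0.

Lemma subtree_mass_ge0 n e : 0 <= subtree_mass n e.
Proof.
elim: n e => [|n IH] e /=; rewrite addr_ge0 ?mulr_ge0 ?sumr_ge0 //; exact: ltW.
Qed.

Lemma subtree_mass_mono m n e : (m <= n)%N -> subtree_mass m e <= subtree_mass n e.
Proof.
elim: n m e => [|n IH] [|m] e //= mn; rewrite lerD2l.
  by apply: sumr_ge0 => c _; exact: subtree_mass_ge0.
by apply: ler_sum => c _; exact: IH.
Qed.

Lemma sum_level_subtree_mass k n : \sum_(e <- level k) subtree_mass n e =
  \sum_(i < n.+1) \sum_(e <- level (k + i)) theta e * rho e.
Proof.
elim: n k => [|n IH] k.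
  by rewrite big_ord1 addn0; apply: eq_bigr => e _ /=; rewrite addr0.
rewrite big_split /= sum_offspring_level IH [RHS]big_ord_recl addn0; congr (_ + _).
by apply: eq_bigr => i _; rewrite addSnnS.
Qed.

Definition light e b := forall n, subtree_mass n e <= theta e * b.

(** Otherwise each edge of [s] exceeds its share at some depth; by monotonicity all exceed it at the
    largest of these depths, and summing contradicts the hypothesis there. *)
Lemma light_exists (s : seq (edge G)) b : s != [::] ->
  (forall n, \sum_(e <- s) subtree_mass n e <= (\sum_(e <- s) theta e) * b) ->
  exists2 e, e \in s & light e b.
Proof.
move=> s_neq0 h; apply: contrapT => /forall2NP nlight.
have {}nlight e : exists n, e \in s -> theta e * b < subtree_mass n e.
  have [es|es] := boolP (e \in s); last by exists 0%N.
  case: (nlight e) => // /existsNP[n /negP]; rewrite -ltNge => hn.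
  by exists n.
have [M hM] := choice nlight.
have := h (\max_(e <- s) M e); apply/negP; rewrite -ltNge mulr_suml.
rewrite big_seq [ltRHS]big_seq; apply: ltr_sum => [|e es].
  by case: s s_neq0 {h nlight hM} => // x s _; rewrite /= mem_head.
apply: lt_le_trans (hM e es) (subtree_mass_mono _ _).
exact: leq_bigmax_seq.
Qed.

Lemma light_path (a : R) : \sum_(e <- level 0) theta e = 1 ->
  (forall n, \sum_(i < n) \sum_(e <- level i) theta e * rho e <= a) ->
  exists2 g, Gamma_oo g & (rho_length rho g <= a%:E)%E.
Proof.
move=> theta1 ha.
have [e0 e0_root light0] : exists2 e, e \in level 0 & light e a.
  apply: light_exists => [|n]; last by rewrite sum_level_subtree_mass theta1 mul1r.
  exact/enum_fset_neq0/level_neq0.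
(* A state is the current edge with the budget left for its subtree; a step pays [rho] on that edge
   and passes to a light child. States that are not light get a dummy successor, so that [choice]
   applies. *)
have step (x : edge G * R) : exists y, light x.1 x.2 ->
    [/\ parent x.1 y.1, light y.1 y.2 & x.2 = rho x.1 + y.2].
  case: x => e b /=; have [lt_eb|] := pselect (light e b); last by exists (e, b).
  have [|n|c ec light_c] := @light_exists (offspring e) (b - rho e).
  - exact/enum_fset_neq0/offspring_neq0.
  (* Lightness of [e] at depth [n.+1], minus the term of [e] itself, bounds the children at depth
     [n]. *)
  - by rewrite theta_offspring mulrBr lerBrDl; exact: lt_eb n.+1.
  - by exists (c, b - rho e) => _; split; rewrite ?subrKC //; apply/in_offspring.
have [F hF] := choice step; pose x n := iter n F (e0, a).
have light_x n : light (x n).1 (x n).2.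
  by elim: n => [|n IH] //=; have [] := hF _ IH.
have partial n : \sum_(0 <= i < n) rho (x i).1 + (x n).2 = a.
  elim: n => [|n <-]; first by rewrite big_geq // add0r.
  by rewrite big_nat_recr //= -addrA; congr (_ + _); have [_ _ ->] := hF _ (light_x n).
(* Lightness at depth 0 says that the budget is at least [rho] of the current edge. *)
have budget_ge0 n : 0 <= (x n).2.
  have := light_x n 0%N; rewrite /= addr0 ler_pM2l //; exact: le_trans.
exists (fun n => (x n).1).
  split=> [|i]; last by have [] := hF _ (light_x i).
  by apply/generation_root/eqP; rewrite -in_level.
apply: (@nneseries_le _ _ 0) => // n _.
by rewrite -(big_mkord xpredT (fun i => rho (x i).1)) -(partial n) lerDl.
Qed.

End Greedy.
End Levels.

(** * Radial densities *)

Section Radial.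
Context {R : realType}.
Variables (G : weighted_rooted_tree R) (p : R).
Hypotheses (Gsym : radially_symmetric_tree G) (wsym : radially_symmetric_weight G).
Hypothesis p_gt1 : 1 < p.
Local Notation level := (level G).
Let proper : proper_infinite_tree G := proj1 Gsym.

Let p_gt0 : 0 < p. Proof. exact: lt_trans p_gt1. Qed.

(** The levels partition the edges and the terms are nonnegative, so the sum can be regrouped by
    generation. *)
Lemma energyE (rho : edge G -> R) : energy p rho =
  (\sum_(0 <= n <oo) (\sum_(e <- level n) weight G e * rho e `^ p)%:E)%E.
Proof.
have f_ge0 e : (0 <= (weight G e * rho e `^ p)%:E)%E.
  by rewrite lee_fin mulr_ge0 ?powR_ge0 // ltW // weight_gt0.
have -> : energy p rho = (\esum_(e in \bigcup_n [set e : edge G | generation e = n.+1])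
    (weight G e * rho e `^ p)%:E)%E.
  congr (esum _ _); apply/seteqP; split=> // e _.
  by exists (generation e).-1; rewrite //= prednK // generation_gt0.
rewrite nneseries_sum_bigcup //; last first.
  by apply/trivIsetP => i j _ _ ij; apply/seteqP; split => // e /= [-> [eij]];
     rewrite eij eqxx in ij.
apply: eq_eseriesr => n _; rewrite esum_fset //; last exact: finite_generation.
rewrite fsumEFin; last exact: finite_generation.
congr (_%:E); rewrite fsbig_finite //; exact: finite_generation.
Qed.

(** * The uniform flow and the extremal profile *)

Definition level_weight n := \sum_(e <- level n) weight G e.

(* By radial symmetry, the unit flow from the root that splits equally among children. *)
Definition uniform_flow (e : edge G) : R := (#|` level (generation e).-1|)%:R^-1.

Lemma card_level_gt0 n : 0 < (#|` level n|)%:R :> R.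
Proof. by rewrite ltr0n cardfs_gt0 level_neq0. Qed.

Lemma uniform_flow_gt0 e : 0 < uniform_flow e.
Proof. by rewrite invr_gt0 card_level_gt0. Qed.

Lemma uniform_flow_level n e : e \in level n -> uniform_flow e = (#|` level n|)%:R^-1.
Proof. by rewrite in_level // /uniform_flow => /eqP ->. Qed.

Lemma sum_level_const n (f : edge G -> R) x : {in level n, forall e, f e = x} ->
  \sum_(e <- level n) f e = (#|` level n|)%:R * x.
Proof.
move=> fx; rewrite (eq_big_seq (fun=> x)) //.
by rewrite big_const_seq count_predT iter_addr_0 mulr_natl.
Qed.

Lemma sum_level_uniform_flow n : \sum_(e <- level n) uniform_flow e = 1.
Proof.
rewrite (sum_level_const (@uniform_flow_level n)) divff // gt_eqF //.
exact: card_level_gt0.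
Qed.

(** By symmetry the children of an edge of level n carry the same total flow for every such edge;
    these totals add up to 1 over the level, as do the equal values of the flow itself. *)
Lemma uniform_flow_offspring e : \sum_(c <- offspring e) uniform_flow c = uniform_flow e.
Proof.
have [n en] : exists n, e \in level n.
  by exists (generation e).-1; rewrite in_level // prednK // generation_gt0.
have off e' : e' \in level n -> #|` offspring e'| = #|` offspring e|.
  move: en; rewrite !in_level // => /eqP ge /eqP ge'.
  apply/fcard_eq; try exact: finite_children.
  by apply: (proj2 Gsym); rewrite ge ge'.
have flow_child e' : e' \in level n ->
    \sum_(c <- offspring e') uniform_flow c =
    (#|` offspring e|)%:R * (#|` level n.+1|)%:R^-1.
  move=> e'n; rewrite (eq_big_seq (fun=> (#|` level n.+1|)%:R^-1)).
    by rewrite big_const_seq count_predT iter_addr_0 mulr_natl off.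
  move=> c /(in_offspring proper)[_ gc]; apply: uniform_flow_level.
  by move: e'n; rewrite !in_level // gc => /eqP ->.
have := sum_offspring_level proper uniform_flow n.
rewrite (sum_level_const flow_child) sum_level_uniform_flow flow_child //.
rewrite (uniform_flow_level en) => /(canRL (mulKf _)) ->; first by rewrite mulr1.
by rewrite gt_eqF ?card_level_gt0.
Qed.

Lemma weight_level n e : e \in level n -> weight G e = level_weight n * uniform_flow e.
Proof.
move=> en; rewrite (uniform_flow_level en) /level_weight.
rewrite (@sum_level_const _ _ (weight G e)).
  by rewrite mulrAC divff ?mul1r // gt_eqF ?card_level_gt0.
move=> e' e'n; apply: wsym.
by move: en e'n; rewrite !in_level // => /eqP -> /eqP ->.
Qed.

Lemma level_weight_gt0 n : 0 < level_weight n.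
Proof.
have /fset0Pn[e en] := level_neq0 proper n.
by have := weight_gt0 e; rewrite (weight_level en) pmulr_lgt0 ?uniform_flow_gt0.
Qed.

(* Chosen so that [level_weight n * profile n `^ (p - 1) = 1]: the values of the
   unnormalized extremal density. *)
Definition profile n := level_weight n `^ (- (p - 1)^-1).

Lemma profile_gt0 n : 0 < profile n.
Proof. by rewrite powR_gt0 // level_weight_gt0. Qed.

Lemma level_weight_profile n : level_weight n * profile n `^ (p - 1) = 1.
Proof.
rewrite /profile -powRrM mulNr mulVf; last by rewrite subr_eq0 gt_eqF.
by rewrite powRN powRr1 ?ltW ?level_weight_gt0 // divff // gt_eqF ?level_weight_gt0.
Qed.

(** The value does not depend on [n]: up to the factor [p], this is the stationarity condition for
    the energy of radial densities of fixed total. *)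
Lemma level_weight_profile_div n (t : R) : 0 < t ->
  level_weight n * (profile n / t) `^ (p - 1) = (t `^ (p - 1))^-1.
Proof.
move=> t0; rewrite powRM ?invr_ge0 ?ltW ?profile_gt0 //.
rewrite mulrA level_weight_profile mul1r -(powR_inv1 (ltW t0)) -powRrM mulN1r.
by rewrite powRN.
Qed.

(** * Energy bounds for radial and for admissible densities *)

Definition radial (r : nat -> R) (e : edge G) := r (generation e).-1.

Lemma radial_level n e r : e \in level n -> radial r e = r n.
Proof. by rewrite in_level // /radial => /eqP ->. Qed.

(** An infinite descending path meets each generation exactly once, so all of them have the same
    length. *)
Lemma radial_Adm r : (forall n, 0 <= r n) ->
  (1%:E <= \sum_(0 <= i <oo) (r i)%:E)%E -> Adm (radial r).
Proof.
move=> r0 r1; split=> [e|g [g0 gS]]; first exact: r0.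
have gen i : generation (g i) = i.+1.
  by elim: i => [|i IH]; [exact/generation_root|have [_ ->] := gS i; rewrite IH].
by rewrite /rho_length /radial; under eq_eseriesr do rewrite gen /=.
Qed.

(** [D] selects all generations for the optimal density and an initial segment for truncations. By
    [level_weight_profile_div], each selected level contributes the bound times [profile n / t]. *)
Lemma energy_radial_le (D : pred nat) m (t : R) : 0 < t ->
  (forall n, (m <= n)%N -> \sum_(i < n | D i) profile i <= t) ->
  (energy p (radial (fun i => if D i then profile i / t else 0)%R)
     <= ((t `^ (p - 1))^-1)%:E)%E.
Proof.
move=> t0 Dt; rewrite energyE.
have levelE n : \sum_(e <- level n)
    weight G e * radial (fun i => if D i then profile i / t else 0%R) e `^ p =
    (t `^ (p - 1))^-1 * (if D n then profile n / t else 0).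
  have p0 : p != 0 by rewrite gt_eqF.
  under eq_big_seq => e en do
    rewrite (radial_level _ en) (weight_level en) -mulrA mulrCA.
  rewrite -mulr_suml sum_level_uniform_flow mul1r.
  case: (D n); last by rewrite powR0 // !mulr0.
  rewrite -mulr_powRB1 ?divr_ge0 ?ltW ?profile_gt0 //.
  by rewrite mulrCA level_weight_profile_div // mulrC.
under eq_eseriesr do rewrite levelE.
apply: (@nneseries_le _ _ m) => [n|n mn].
  by rewrite mulr_ge0 ?invr_ge0 ?powR_ge0 //; case: ifP => // _;
    rewrite divr_ge0 // ltW // profile_gt0.
rewrite -mulr_sumr ger_pMr ?invr_gt0 ?powR_gt0 // -big_mkcond -mulr_suml.
by rewrite ler_pdivrMr // mul1r Dt.
Qed.

Lemma Adm_energy_ge (rho : edge G -> R) (t : R) : Adm rho -> 0 < t ->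
  (forall n, \sum_(i < n) profile i <= t) ->
  (((t `^ (p - 1))^-1)%:E <= energy p rho)%E.
Proof.
move=> [rho0 rho_adm] t0 profile_t.
set K := (t `^ (p - 1))^-1; have K0 : 0 < K by rewrite invr_gt0 powR_gt0.
pose mass n := \sum_(i < n) \sum_(e <- level i) uniform_flow e * rho e.
(* Tangent inequality on each edge; the linear term becomes [K * p] times the flow times [rho], with
   the same factor on all levels. *)
have level_ge n : K * (p * (\sum_(e <- level n) uniform_flow e * rho e)
    - (p - 1) * (profile n / t)) <= \sum_(e <- level n) weight G e * rho e `^ p.
  have r0 : 0 <= profile n / t by rewrite divr_ge0 ?ltW ?profile_gt0.
  have -> : K * (p * (\sum_(e <- level n) uniform_flow e * rho e)
    - (p - 1) * (profile n / t)) = \sum_(e <- level n) weight G e *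
      (p * (profile n / t) `^ (p - 1) * rho e - (p - 1) * (profile n / t) `^ p).
    (* Inserting the total flow 1 turns the constant term into a sum over the level. *)
    have {1}-> : (p - 1) * (profile n / t) =
        (p - 1) * (\sum_(e <- level n) uniform_flow e) * (profile n / t).
      by rewrite sum_level_uniform_flow mulr1.
    rewrite !mulr_sumr mulr_suml -sumrB mulr_sumr; apply: eq_big_seq => e en.
    rewrite (weight_level en) /K -(level_weight_profile_div n t0).
    rewrite -[(profile n / t) `^ p]mulr_powRB1 //.
    move: (profile n / t) => x; move: (x `^ (p - 1)) => y.
    rewrite -!mulrA; congr (_ * _); rewrite !mulrBr; congr (_ - _).
      by rewrite [LHS]mulrCA [RHS]mulrCA; congr (_ * _); rewrite mulrCA.
    by rewrite [LHS]mulrCA [RHS]mulrCA; congr (_ * _); rewrite mulrCA [y * _]mulrC.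
  apply: ler_sum => e _; rewrite ler_pM2l ?weight_gt0 //.
  exact: powR_tangent_le.
(* The constant terms total at most [K * (p - 1)], since the profiles sum to at most [t]. *)
have mass_energy n : ((K * (p * mass n - (p - 1)))%:E <= energy p rho)%E.
  rewrite energyE; apply: le_trans; last first.
    apply: (@le_nneseries _ (fun i => \sum_(e <- level i) weight G e * rho e `^ p) n).
    by move=> k; apply: sumr_ge0 => e _; rewrite mulr_ge0 ?powR_ge0 // ltW // weight_gt0.
  rewrite lee_fin; apply: le_trans; last by apply: ler_sum => i _; exact: level_ge.
  rewrite -mulr_sumr sumrB -!mulr_sumr ler_pM2l // lerB //.
  rewrite -[leRHS]mulr1 ler_pM2l ?subr_gt0 // -mulr_suml.
  by rewrite ler_pdivrMr // mul1r.
rewrite leNgt; apply/negP => energy_lt.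
have [E energyE'] : exists E, energy p rho = E%:E.
  case: (energy p rho) (mass_energy 0%N) energy_lt => [E| |] //.
  by exists E.
(* The mass at which the bound [mass_energy] equals [E]; it is below 1 because [E < K]. *)
have a1 : (E / K + (p - 1)) / p < 1.
  move: energy_lt; rewrite energyE' lte_fin => EK.
  rewrite ltr_pdivrMr // mul1r -ltrBrDr subKr ltr_pdivrMr //.
  by rewrite mul1r.
have mass_le n : mass n <= (E / K + (p - 1)) / p.
  have := mass_energy n; rewrite energyE' lee_fin => h.
  by rewrite ler_pdivlMr // -lerBlDr ler_pdivlMr // mulrC [mass n * p]mulrC.
have [g gG length_g] := light_path proper uniform_flow_gt0 rho0 uniform_flow_offspring
  (sum_level_uniform_flow 0) mass_le.
have := rho_adm _ gG; apply/negP; rewrite -ltNge.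
by apply: le_lt_trans length_g _; rewrite lte_fin.
Qed.

Lemma radial_profile_optimal (t : R) : 0 < t ->
  (\sum_(0 <= i <oo) (profile i)%:E = t%:E)%E ->
  optimal_density G p (radial (fun i => profile i / t)).
Proof.
move=> t0 profile_sum.
have profile_le n : \sum_(i < n) profile i <= t.
  by rewrite -lee_fin -profile_sum le_nneseries // => i; rewrite ltW ?profile_gt0.
have adm : Adm (radial (fun i => profile i / t)).
  apply: radial_Adm => [n|]; first by rewrite divr_ge0 ?ltW ?profile_gt0.
  under eq_eseriesr do rewrite mulrC EFinM.
  rewrite nneseriesZl => [|i _]; last by rewrite lee_fin ltW ?profile_gt0.
  by rewrite profile_sum -EFinM mulVf ?gt_eqF.
split=> //; apply/eqP; rewrite eq_le; apply/andP; split.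
  (* The (1 - p)-th power of [t] lies above this energy and below that of every admissible
     density. *)
  apply: le_trans (@energy_radial_le xpredT 0 _ t0 (fun n _ => profile_le n)) _.
  by apply: le_ereal_inf_tmp => _ [rho rho_adm <-]; exact: Adm_energy_ge.
by apply: ereal_inf_lbound; exists (radial (fun i => profile i / t)).
Qed.

Lemma Mod_le_truncation m : 0 < \sum_(i < m) profile i ->
  (Mod G p <= (((\sum_(i < m) profile i) `^ (p - 1))^-1)%:E)%E.
Proof.
set t := \sum_(i < m) _ => t0.
have truncE n : (m <= n)%N -> \sum_(i < n | (i < m)%N) profile i = t.
  by move=> mn; rewrite -big_ord_widen.
have trunc_ge0 n : 0 <= (if (n < m)%N then profile n / t else 0).
  by case: ifP => // _; rewrite divr_ge0 ?ltW ?profile_gt0.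
apply: le_trans (@energy_radial_le (fun i => (i < m)%N) m _ t0 _).
  apply: ereal_inf_lbound; eexists; last reflexivity.
  apply: radial_Adm => //; apply: le_trans (le_nneseries m trunc_ge0).
  by rewrite lee_fin -big_mkcond -mulr_suml truncE // divff ?gt_eqF.
by move=> n mn; rewrite truncE.
Qed.

(** * Positivity of the modulus and existence of an optimal density *)

Lemma optimal_density_Mod_gt0 (rho : edge G -> R) :
  optimal_density G p rho -> (0 < Mod G p)%E.
Proof.
move=> [[rho0 rho_adm] <-]; rewrite ltNge; apply/negP => energy0.
have rhoE e : rho e = 0.
  have f_ge0 c : (0 <= (weight G c * rho c `^ p)%:E)%E.
    by rewrite lee_fin mulr_ge0 ?powR_ge0 // ltW // weight_gt0.
  have : ((weight G e * rho e `^ p)%:E <= energy p rho)%E.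
    apply: esum_ge; exists [set e]; first by split => //; exact: finite_set1.
    by rewrite fsbig_set1.
  move=> /le_trans/(_ energy0); rewrite lee_fin pmulr_rle0 ?weight_gt0 // => rho_le0.
  have : rho e `^ p = 0 by apply/eqP; rewrite eq_le rho_le0 powR_ge0.
  by move=> /powR_eq0_eq0.
(* A zero budget in [light_path] yields an infinite descending path of length at most 0. *)
have mass0 n : \sum_(i < n) \sum_(e <- level i) uniform_flow e * rho e <= 0.
  by rewrite big1 // => i _; rewrite big1 // => e _; rewrite rhoE mulr0.
have [g gG length_g] := light_path proper uniform_flow_gt0 rho0 uniform_flow_offspring
  (sum_level_uniform_flow 0) mass0.
have := rho_adm _ gG; apply/negP; rewrite -ltNge.
by apply: le_lt_trans length_g _; rewrite lte_fin.
Qed.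

Lemma Mod_gt0_optimal_density :
  (0 < Mod G p)%E -> exists rho : edge G -> R, optimal_density G p rho.
Proof.
move=> Mod_gt0; have profile_ge0 i : 0 <= profile i by rewrite ltW ?profile_gt0.
have [[t profile_le]|unbounded] :=
    pselect (exists t, forall n, \sum_(i < n) profile i <= t).
  have := @nneseries_le _ _ 0 t profile_ge0 (fun n _ => profile_le n).
  (* The first partial sum, [profile 0], makes the sum of the series positive. *)
  have := @le_nneseries _ _ 1 profile_ge0; rewrite big_ord1.
  case E : (\sum_(0 <= i <oo) _)%E => [s| |] //; rewrite lee_fin => profile_s _.
  exists (radial (fun i => profile i / s)); apply: radial_profile_optimal => //.
  exact: lt_le_trans (profile_gt0 0) profile_s.
(* The modulus is not yet known to be finite, so [M] is only a positive lower bound. *)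
have [M M0 M_lt] : exists2 M, 0 < M & (M%:E <= Mod G p)%E.
  case: (Mod G p) Mod_gt0 => [M| |] // M0; first by exists M.
  by exists 1 => //; rewrite leey.
have p1 : p - 1 != 0 by rewrite subr_eq0 gt_eqF.
(* The witness solves t^(1 - p) = M: a larger partial sum would push the modulus below [M] by
   [Mod_le_truncation]. *)
exfalso; apply: unbounded; exists (M^-1 `^ (p - 1)^-1) => m; rewrite leNgt.
apply/negP => profile_m.
have t0 : 0 < \sum_(i < m) profile i by apply: le_lt_trans profile_m; exact: powR_ge0.
have := le_trans M_lt (Mod_le_truncation t0); rewrite lee_fin.
apply/negP; rewrite -ltNge invf_plt ?posrE ?powR_gt0 //.
have pm1 : 0 < p - 1 by rewrite subr_gt0.
have := gt0_ltr_powR pm1 _ _ profile_m; rewrite !nnegrE powR_ge0 (ltW t0).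
by rewrite -powRrM mulVf // powRr1 ?invr_ge0 ?(ltW M0) // => /(_ isT isT).
Qed.

End Radial.

Theorem theorem4 (R : realType) (G : weighted_rooted_tree R) (p : R)
    (Gsym : radially_symmetric_tree G) (wsym : radially_symmetric_weight G)
    (p_gt1 : 1 < p) :
  (exists rho : edge G -> R, optimal_density G p rho) <-> (0 < Mod G p)%E.
Proof.
split=> [[rho]|]; first exact: optimal_density_Mod_gt0.
exact: Mod_gt0_optimal_density.
Qed.
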